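(* If an RCRS is $c$-selectable on all bipartite graphs (with all fractional matchings), then $c\le 1/2$. That is, no RCRS is better than $1/2$-selectable on bipartite graphs.
   Context: For a finite graph $G=(V,E)$, a fractional matching is $\bm{x}\in[0,1]^E$ with $\sum_{e\ni v}x_e\le1$ for every vertex $v$. Each edge $e$ is active independently with probability $x_e$. A random-order contention resolution scheme (RCRS) is given $G$ and $\bm{x}$; the edges are presented to it one at a time in a uniformly random order; upon the arrival of $e$ it learns whether $e$ is active and must irrevocably decide (possibly using randomness) whether to select $e$; only active edges may be selected and the selected edges must form a matching. An RCRS is $c$-selectable on a class of inputs if on each input of the class every edge $e$ is selected with probability at least $cx_e$. *)

(* Defs.v *)
From HB Require Import structures.
From mathcomp Require Import all_boot all_order all_algebra.
From mathcomp Require Import all_classical all_reals all_analysis.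
Set Implicit Arguments.
Unset Strict Implicit.
Unset Printing Implicit Defensive.
Import Order.TTheory GRing.Theory Num.Theory.
Local Open Scope ring_scope.

Record graph := Graph {
  vertex : finType;
  edges : {set {set vertex}};
  edges_card2 : forall e, e \in edges -> #|e| = 2%N }.

Definition edge (G : graph) : finType := {e : {set vertex G} | e \in edges G}.

Definition endpoints (G : graph) (e : edge G) : {set vertex G} := val e.

Definition bipartite (G : graph) : Prop :=
  exists L : {set vertex G}, forall e : edge G,
    exists u v, [/\ u \in L, v \notin L & endpoints e = [set u; v]%SET].

Definition matching (G : graph) (M : {set edge G}) : Prop :=
  forall e f, e \in M -> f \in M -> e != f ->
    [disjoint endpoints e & endpoints f].

Definition fractional_matching (R : realType) (G : graph) (x : edge G -> R) :=
  (forall e, 0 <= x e <= 1) /\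
  (forall v, \sum_(e | v \in endpoints e) x e <= 1).

Record input (R : realType) := Input {
  igraph : graph;
  ix : edge igraph -> R;
  ix_frac : fractional_matching ix }.

Definition is_order (G : graph) (s : seq (edge G)) : bool :=
  perm_eq s (enum (edge G)).

(* The edges that arrived strictly before [e], in order of arrival, each with
   its state, when the arrival order is [s] and [A] is the set of active edges. *)
Definition history (G : graph) (s : seq (edge G)) (A : {set edge G})
    (e : edge G) : seq (edge G * bool) :=
  [seq (f, f \in A) | f <- take (index e s) s].

(* An online decision rule with internal randomness [w : W]: [acc w h e b] is
   the decision on the arriving edge [e], whose state is [b], after the history
   [h].  Earlier decisions are functions of [w] and [h], so they need not be
   recorded in [h].  The result is the set of edges eventually selected. *)
Definition selected (G : graph) (W : Type)
    (acc : W -> seq (edge G * bool) -> edge G -> bool -> bool)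
    (w : W) (s : seq (edge G)) (A : {set edge G}) : {set edge G} :=
  [set e | acc w (history s A e) e (e \in A)]%SET.

(* All the random bits of the algorithm are gathered in a seed, drawn from an
   arbitrary probability space, independently of the arrival order and of the
   activity of the edges. *)
Record scheme (R : realType) (G : graph) := Scheme {
  seed_display : measure_display;
  seed : measurableType seed_display;
  seed_law : probability seed R;
  accept : seed -> seq (edge G * bool) -> edge G -> bool -> bool;
  accept_measurable : forall h e b, measurable [set w | accept w h e b]%classic;
  accept_active : forall w s A, is_order s -> selected accept w s A \subset A;
  accept_matching : forall w s A, is_order s -> matching (selected accept w s A) }.

Definition rcrs (R : realType) := forall I : input R, scheme R (igraph I).

Definition activity_prob (R : realType) (G : graph) (x : edge G -> R)
    (A : {set edge G}) : R :=
  (\prod_(e in A) x e) * (\prod_(e in ~: A) (1 - x e)).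

(* The order is uniform, the edges are independently active, and the order, the
   set of active edges and the seed are independent. *)
Definition selection_prob (R : realType) (G : graph) (x : edge G -> R)
    (S : scheme R G) (e : edge G) : R :=
  ((#|edge G|)`!%:R)^-1 *
  \sum_(s <- permutations (enum (edge G))) \sum_(A : {set edge G})
    activity_prob x A *
    fine (seed_law S [set w | e \in selected (@accept R G S) w s A]%classic).

Definition selectable_on (R : realType) (C : input R -> Prop) (c : R)
    (rho : rcrs R) : Prop :=
  forall I : input R, C I ->
    forall e : edge (igraph I), c * ix e <= selection_prob (@ix R I) (rho I) e.

(* Main.v *)
(* On K_{n,n} with the constant fractional matching 1/n, the selectability c is
   at most E|M|/n, where M is the selected matching, so it suffices to show
   E|M| <= n/2 + o(n), and by averaging over the seed the rule may be taken
   deterministic.  If u is the fraction of unmatched vertices when a fraction s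
   of the pairs is still to come, the free pairs form a combinatorial rectangle
   of size (un)^2.  The unseen pairs are spread evenly over all rectangles (a
   bound on the fourth moment, obtained by applying Cauchy-Schwarz twice and
   counting 4-cycles), so the next pair is free with probability about u^2 and
   active with probability 1/n.  Hence u decreases at most at the rate of
   u' = -u^2, the rate of the greedy rule; along that flow u/(1+us) is constant,
   which makes it almost a submartingale for any rule.  It goes from 1/2 to the
   final u = 1 - |M|/n. *)

Require Import Defs.
From mathcomp Require Import all_boot all_order all_algebra.
From mathcomp Require Import all_classical all_reals all_analysis.
From mathcomp Require Import measurable_realfun all_fingroup.
From mathcomp Require Import ring lra zify.
Local Open Scope ring_scope.

Set Implicit Arguments.
Unset Strict Implicit.
Unset Printing Implicit Defensive.
Import Order.TTheory GRing.Theory Num.Theory.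

(** * Sums over permutations and over random subsets *)

(** Cauchy-Schwarz against the indicator of [P], from the nonnegative double sum of
    [(g i - g j) ^+ 2], where [g] is [f] cut off outside [P]. *)
Lemma sum_sqr_le (R : realFieldType) (I : finType) (P : {set I}) (f : I -> R) :
  (\sum_(i in P) f i) ^+ 2 <= #|I|%:R * \sum_i f i ^+ 2.
Proof.
have -> : \sum_(i in P) f i = \sum_i (if i \in P then f i else 0).
  by rewrite big_mkcond.
set g := fun i => if i \in P then f i else 0.
have -> : \sum_i (if i \in P then f i else 0) = \sum_i g i by [].
apply: (@le_trans _ _ (#|I|%:R * \sum_i g i ^+ 2)); last first.
  apply: ler_wpM2l; first exact: ler0n.
  apply: ler_sum => i _; rewrite /g; case: ifP => // _.
  by rewrite expr0n /= sqr_ge0.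
have h0 : 0 <= \sum_i \sum_j (g i - g j) ^+ 2.
  by apply: sumr_ge0 => i _; apply: sumr_ge0 => j _; exact: sqr_ge0.
have e1 : \sum_i \sum_j (g i - g j) ^+ 2 =
    (#|I|%:R * \sum_i g i ^+ 2) *+ 2 - ((\sum_i g i) ^+ 2) *+ 2.
  have -> : \sum_i \sum_j (g i - g j) ^+ 2 =
      \sum_i (#|I|%:R * g i ^+ 2 + (\sum_j g j ^+ 2)
              - g i * (\sum_j g j) *+ 2).
    apply: eq_bigr => i _.
    rewrite (eq_bigr (fun j => g i ^+ 2 + g j ^+ 2 - g i * g j *+ 2)); last first.
      by move=> j _; rewrite sqrrB; ring.
    by rewrite sumrB big_split /= sumr_const sumrMnl mulr_sumr mulr_natl.
  rewrite sumrB big_split /= -mulr_sumr sumr_const sumrMnl -mulr_suml.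
  by rewrite -[X in _ + X - _]mulr_natl expr2 mulr2n.
rewrite e1 in h0.
rewrite -subr_ge0 -(pmulrn_lge0 _ (ltn0Sn 1)).
by rewrite mulrnBl.
Qed.

(** Cauchy-Schwarz over the rows, then over the pairs of columns. The bound no longer mentions [F]
    and [F'], so it may be applied to a rectangle that depends on the whole past. *)
Lemma rect_sum_le (R : realFieldType) (I J : finType) (B : I -> J -> R)
    (F : {set I}) (F' : {set J}) :
  (\sum_(a in F) \sum_(b in F') B a b) ^+ 4 <=
  (#|I| * #|J|)%:R ^+ 2 * \sum_b \sum_b' (\sum_a B a b * B a b') ^+ 2.
Proof.
pose g a := \sum_(b in F') B a b.
have h1 : (\sum_(a in F) g a) ^+ 2 <= #|I|%:R * \sum_a g a ^+ 2.
  exact: sum_sqr_le.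
pose C (p : J * J) := \sum_a B a p.1 * B a p.2.
have h2 : \sum_a g a ^+ 2 = \sum_(p in finset.setX F' F') C p.
  rewrite /C exchange_big /=; apply: eq_bigr => a _.
  rewrite expr2 /g big_distrlr /= pair_big /=.
  by apply: eq_bigl => p; rewrite inE.
have h3 : (\sum_(p in finset.setX F' F') C p) ^+ 2 <= #|{: J * J}|%:R * \sum_p C p ^+ 2.
  exact: sum_sqr_le.
have h4 : \sum_p C p ^+ 2 = \sum_b \sum_b' (\sum_a B a b * B a b') ^+ 2.
  by rewrite pair_big.
rewrite (_ : 4%N = (2 * 2)%N) // exprM.
apply: (@le_trans _ _ ((#|I|%:R * \sum_a g a ^+ 2) ^+ 2)).
  by rewrite lerXn2r // nnegrE ?sqr_ge0 // (le_trans _ h1) // sqr_ge0.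
rewrite exprMn h2 natrM (exprMn _ #|I|%:R) -[X in _ <= X]mulrA ler_wpM2l ?sqr_ge0 //.
by rewrite -h4 (le_trans h3) // card_prod natrM -expr2.
Qed.

Lemma card_rank_ge (T : finType) (i : nat) :
  #|[pred t : T | (i <= enum_rank t)%N]| = (#|T| - i)%N.
Proof.
rewrite -[LHS]sum1_card (reindex _ (onW_bij _ (@enum_val_bij T))) /=.
rewrite (eq_bigl (fun j : 'I_#|T| => (i <= j)%N)); last first.
  by move=> j; rewrite inE enum_valK.
rewrite -(big_mkord (fun j => (i <= j)%N) (fun=> 1%N)).
by rewrite -(big_nat_widenl i 0 #|T| predT) // sum_nat_const_nat muln1.
Qed.

(* Conditionally on the first [i] entries of a uniform order, its entry of
   rank [i] is uniform among the remaining elements. *)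
Lemma sum_perm_next (V : zmodType) (T : finType) (i : nat) (k : T)
    (h : {perm T} -> T -> V) :
  enum_rank k = i :> nat ->
  (forall (s s' : {perm T}) t, (forall j, (enum_rank j < i)%N -> s j = s' j) ->
     h s t = h s' t) ->
  (\sum_(s : {perm T}) h s (s k)) *+ (#|T| - i) =
  \sum_(s : {perm T}) \sum_(t | (i <= enum_rank (s^-1%g t))%N) h s t.
Proof.
move=> rk hE.
(* Exchanging the positions [k] and [j] leaves the first [i] entries, hence [h], unchanged. *)
have e1 (j : T) : (i <= enum_rank j)%N ->
    \sum_(s : {perm T}) h s (s j) = \sum_s h s (s k).
  move=> ij.
  rewrite (reindex_inj (mulgI (tperm k j))) /=.
  apply: eq_bigr => s _; rewrite permM tpermR; apply: hE => l li.
  rewrite permM tpermD //; apply/eqP => e; first by move: li; rewrite -e rk ltnn.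
  by move: li; rewrite -e ltnNge ij.
transitivity (\sum_s \sum_(j | (i <= enum_rank j)%N) h s (s j)).
  rewrite exchange_big /= (eq_bigr _ e1) sumr_const; congr (_ *+ _).
  exact/esym/card_rank_ge.
apply: eq_bigr => s _.
rewrite [RHS](reindex_inj (@perm_inj _ s)) /=.
by apply: eq_bigl => j; rewrite permK.
Qed.

(* By exchangeability, the sum over [s] does not depend on [e4] outside
   [e1, e2, e3], and summing it over all [e4] gives [0]. *)
Lemma sum_perm_prod4 (R : realFieldType) (T : finType) (f : T -> R)
    (e1 e2 e3 e4 : T) :
  \sum_t f t = 0 -> (forall t, `|f t| <= 1) -> uniq [:: e1; e2; e3; e4] ->
  (#|T| - 3)%:R * `|\sum_(s : {perm T}) f (s e1) * f (s e2) * f (s e3) * f (s e4)|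
    <= 3 * #|{perm T}|%:R.
Proof.
move=> f0 f1 U.
pose S e := \sum_(s : {perm T}) f (s e1) * f (s e2) * f (s e3) * f (s e).
have Sle e : `|S e| <= #|{perm T}|%:R.
  rewrite (le_trans (ler_norm_sum _ _ _)) // -sum1_card natr_sum.
  by apply: ler_sum => s _; rewrite !normrM !mulr_ile1 ?mulr_ge0.
have S0 : \sum_e S e = 0.
  rewrite exchange_big big1 //= => s _; rewrite -mulr_sumr.
  have -> : \sum_i f (s i) = 0.
    by rewrite -[RHS]f0 [RHS](reindex_inj (@perm_inj _ s)).
  by rewrite mulr0.
pose D := [set e1; e2; e3]%SET.
have Se e : e \notin D -> S e = S e4.
  rewrite !inE !negb_or => /andP[/andP[n1 n2] n3].
  rewrite /S (reindex_inj (mulgI (tperm e e4))) /=.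
  move: U; rewrite /= !inE !negb_or => /and4P[/and3P[_ _ m1] /andP[_ m2] m3 _].
  by apply: eq_bigr => s _; rewrite !permM tpermL !tpermD // eq_sym.
have cD : #|D| = 3%N.
  move: U; rewrite /= !inE !negb_or => /and4P[/and3P[a b c] /andP[d e] g _].
  by rewrite /D finset.setUC cardsU1 cards2 !inE a negb_or eq_sym b eq_sym d.
have : (#|T| - 3)%:R * S e4 = \sum_(e | e \notin D) S e.
  rewrite (eq_bigr _ Se) sumr_const mulr_natl; congr (_ *+ _).
  by rewrite -cD -(cardC (mem D)) addKn.
have -> : \sum_(e | e \notin D) S e = - \sum_(e in D) S e.
  apply/eqP; rewrite -addr_eq0 addrC; move: S0.
  by rewrite (bigID (mem D)) /= => ->.
move=> /(congr1 Num.norm); rewrite normrM normrN ger0_norm ?ler0n // => ->.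
rewrite (le_trans (ler_norm_sum _ _ _)) //.
rewrite mulr_natl -cD -sumr_const.
by apply: ler_sum.
Qed.

(* The square expands into products over the 4-cycles [a, b, a', b']; the
   degenerate ones number at most [2 n^3]. *)
Lemma sum_perm_codegree (R : realFieldType) (n : nat)
    (f : 'I_n * 'I_n -> R) :
  (1 < n)%N -> \sum_t f t = 0 -> (forall t, `|f t| <= 1) ->
  \sum_(s : {perm 'I_n * 'I_n})
     \sum_b \sum_b' (\sum_a f (s (a, b)) * f (s (a, b'))) ^+ 2 <=
  14 * n%:R ^+ 3 * #|{perm 'I_n * 'I_n}|%:R.
Proof.
move=> n1 f0 f1; set K := #|_|%:R.
have n0 : 0 < n%:R :> R by rewrite ltr0n; lia.
have nn : n%:R != 0 :> R by rewrite gt_eqF.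
(* A degenerate cycle gets the trivial bound [K]. For the others [sum_perm_prod4] gives
   [3 * K / (n ^ 2 - 3)], and [n ^ 2 <= 4 * (n ^ 2 - 3)] for [n >= 2], whence 12. *)
have term (a a' b b' : 'I_n) :
    \sum_(s : {perm 'I_n * 'I_n})
      f (s (a, b)) * f (s (a, b')) * f (s (a', b)) * f (s (a', b')) <=
    K * ((a == a')%:R + (b == b')%:R + 12 / n%:R ^+ 2).
  have c0 : 0 <= 12 / n%:R ^+ 2 :> R by rewrite divr_ge0 ?sqr_ge0.
  set X := \sum_(s : {perm 'I_n * 'I_n}) _.
  have XK : `|X| <= K.
    rewrite (le_trans (ler_norm_sum _ _ _)) // /K -sum1_card natr_sum.
    by apply: ler_sum => s _; rewrite !normrM !mulr_ile1 ?mulr_ge0.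
  have XK' := le_trans (ler_norm X) XK.
  have K0 : 0 <= K by exact: ler0n.
  have [_|na] := eqVneq a a'.
    apply: (le_trans XK'); rewrite ler_peMr //= -addrA lerDl addr_ge0 ?ler0n //.
  have [_|nb] := eqVneq b b'.
    by apply: (le_trans XK'); rewrite ler_peMr //= add0r lerDl.
  rewrite /= !add0r mulrCA.
  have U : uniq [:: (a, b); (a, b'); (a', b); (a', b')].
    by rewrite /= !inE !xpair_eqE !eqxx (negbTE na) (negbTE nb)
       eq_sym (negbTE nb) !andbF.
  have := sum_perm_prod4 f0 f1 U.
  rewrite card_prod !card_ord -/X => h.
  have h4 : n%:R ^+ 2 <= 4 * ((n * n - 3)%N%:R : R).
    rewrite natrB; last by nia.
    rewrite natrM expr2.
    have : (2 : R) <= n%:R by rewrite ler_nat.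
    by nra.
  rewrite mulrA ler_pdivlMr ?exprn_gt0 //.
  apply: (@le_trans _ _ (`|X| * (4 * (n * n - 3)%N%:R))).
    apply: (@le_trans _ _ (`|X| * n%:R ^+ 2)).
      by rewrite ler_wpM2r ?sqr_ge0 // ler_norm.
    by rewrite ler_wpM2l.
  by rewrite -/K in h; lra.
have -> : \sum_(s : {perm 'I_n * 'I_n})
     \sum_b \sum_b' (\sum_a f (s (a, b)) * f (s (a, b'))) ^+ 2 =
   \sum_b \sum_b' \sum_a \sum_a' \sum_(s : {perm 'I_n * 'I_n})
      f (s (a, b)) * f (s (a, b')) * f (s (a', b)) * f (s (a', b')).
  rewrite exchange_big /=; apply: eq_bigr => b _.
  rewrite exchange_big /=; apply: eq_bigr => b' _.
  under eq_bigr do rewrite expr2 big_distrlr /=.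
  rewrite exchange_big /=; apply: eq_bigr => a _.
  rewrite exchange_big /=; apply: eq_bigr => a' _.
  by apply: eq_bigr => s _; rewrite !mulrA.
apply: (@le_trans _ _ (\sum_(b < n) \sum_(b' < n) \sum_(a < n) \sum_(a' < n)
   K * ((a == a')%:R + (b == b')%:R + 12 / n%:R ^+ 2))).
  by do 4![apply: ler_sum => ? _]; exact: term.
have one (a : 'I_n) : \sum_(a' < n) ((a == a')%:R : R) = 1.
  rewrite (bigD1 a) //= eqxx big1 ?addr0 // => i.
  by rewrite eq_sym => /negbTE ->.
have sc (c : R) : \sum_(i < n) c = n%:R * c.
  by rewrite sumr_const card_ord mulr_natl.
have e1 (b b' a : 'I_n) : \sum_(a' < n)
     K * ((a == a')%:R + (b == b')%:R + 12 / n%:R ^+ 2) =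
     K * (1 + 12 / n%:R) + K * n%:R * (b == b')%:R.
  rewrite -mulr_sumr !big_split /= one !sc.
  by field.
under eq_bigr => b _ do under eq_bigr => b' _ do under eq_bigr => a _ do
  rewrite e1.
under eq_bigr => b _ do under eq_bigr => b' _ do
  rewrite sc mulrDr.
under eq_bigr => b _ do
  rewrite big_split /= sc -!mulr_sumr one.
rewrite sc.
rewrite [X in X <= _](_ : _ = K * (2 * n%:R ^+ 3 + 12 * n%:R ^+ 2)); last by field.
rewrite [X in _ <= X]mulrC ler_wpM2l ?ler0n //.
have : (1 : R) <= n%:R by rewrite ler1n; lia.
rewrite !exprS expr0; nra.
Qed.

(** The law of a random subset containing each element independently with probability [x]. *)
Definition weight (R : pzRingType) (T : finType) (x : R) (A : {set T}) : R :=
  \prod_t (if t \in A then x else 1 - x).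

Lemma sum_weight (R : comPzRingType) (T : finType) (x : R) :
  \sum_(A : {set T}) weight x A = 1.
Proof.
rewrite /weight -(bigA_distr _ _ (fun=> x) (fun=> 1 - x)) big1 //= => t _.
by ring.
Qed.

Lemma weight_ge0 (R : numDomainType) (T : finType) (x : R) (A : {set T}) :
  0 <= x <= 1 -> 0 <= weight x A.
Proof.
move=> /andP[x0 x1]; apply: prodr_ge0 => t _.
by case: ifP; rewrite ?subr_ge0.
Qed.

(** Independence: [g] ignores [t], so the event that [t] is in [A] factors out. Toggling [t] (the
    involution [phi]) pairs the sets with [t] and those without. *)
Lemma sum_weight_coord (R : comPzRingType) (T : finType) (x : R) (t : T)
    (g : {set T} -> R) :
  (forall A, g (t |: A) = g (A :\ t)) ->
  \sum_(A : {set T}) weight x A * ((t \in A)%:R * g A) =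
  x * \sum_(A : {set T}) weight x A * g A.
Proof.
move=> gE.
pose w' (A : {set T}) := \prod_(u | u != t) (if u \in A then x else 1 - x : R).
have wE A : weight x A = (if t \in A then x else 1 - x) * w' A.
  by rewrite /weight (bigD1 t).
pose phi (A : {set T}) := if t \in A then A :\ t else t |: A.
have phit A : (t \in phi A) = (t \notin A).
  by rewrite /phi; case: ifP => tA; rewrite !inE eqxx.
have phiK : involutive phi.
  move=> A; rewrite {1}/phi phit /phi.
  by case: (boolP (t \in A)) => tA; [exact: finset.setD1K | exact: finset.setU1K].
have w'phi A : w' (phi A) = w' A.
  apply: eq_bigr => u ut; congr (if _ then _ else _).
  by rewrite /phi; case: ifP => _; rewrite !inE (negbTE ut).
have gphi A : g (phi A) = g A.
  rewrite /phi; case: ifP => tA.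
    by rewrite -gE; congr g; apply/finset.setUidPr; rewrite finset.sub1set.
  by rewrite gE; congr g; apply/finset.setDidPl; rewrite disjoint_sym finset.disjoints1 tA.
set L := \sum_(A : {set T}) _; set Tot := \sum_(A : {set T}) _.
have LE : L = x * \sum_(A : {set T} | t \in A) w' A * g A.
  rewrite /L mulr_sumr [RHS]big_mkcond; apply: eq_bigr => A _.
  by rewrite wE; case: ifP; rewrite ?mul1r ?mul0r ?mulr0 // mulrA.
rewrite LE; congr (_ * _).
rewrite /Tot [RHS](bigID (fun A : {set T} => t \in A)) /=.
rewrite [X in _ = _ + X](reindex_inj (inv_inj phiK)) /=.
rewrite [X in _ = _ + X](eq_bigl (fun A : {set T} => t \in A)); last by move=> A; rewrite phit negbK.
rewrite [X in _ = X + _](eq_bigr (fun A => x * (w' A * g A))); last first.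
  by move=> A tA; rewrite wE tA mulrA.
rewrite [X in _ = _ + X](eq_bigr (fun A => (1 - x) * (w' A * g A))); last first.
  by move=> A tA; rewrite wE phit tA /= w'phi gphi mulrA.
by rewrite -!mulr_sumr -mulrDl addrC subrK mul1r.
Qed.

(** * Online matching in the complete bipartite graph *)

(* The permutation [s] stands for the arrival order that lists [s t] for [t] in
   [enum T]. *)
Definition arrival (T : finType) (s : {perm T}) (t : T) : nat :=
  enum_rank ((s^-1)%g t).

Lemma arrivalE (T : finType) (s : {perm T}) (t : T) :
  arrival s (s t) = enum_rank t.
Proof. by rewrite /arrival permK. Qed.

(* The value after time [s] of the solution of [u' = - u ^+ 2] started at [u]. *)
Definition residue (R : realFieldType) (u s : R) : R := u / (1 + u * s).

(** The residue is convex in [s] with derivative [- u ^+ 2 / (1 + u * s) ^+ 2], so it lies above its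
    tangent at [s]. *)
Lemma residue_wait (R : realFieldType) (u s d : R) :
  0 <= u <= 1 -> 0 <= d -> d <= s -> s <= 1 ->
  residue u s + u ^+ 2 * d / (1 + u * s) ^+ 2 <= residue u (s - d).
Proof.
move=> /andP[u0 u1] d0 ds s1; rewrite /residue.
have p : 0 < 1 + u * s by nra.
have p' : 0 < 1 + u * (s - d) by nra.
rewrite -subr_ge0.
have -> : u / (1 + u * (s - d)) - (u / (1 + u * s) + u ^+ 2 * d / (1 + u * s) ^+ 2) =
  u ^+ 3 * d ^+ 2 / ((1 + u * (s - d)) * (1 + u * s) ^+ 2).
  by field; rewrite !gt_eqF.
by rewrite divr_ge0 // ?mulr_ge0 ?exprn_ge0 ?(ltW p) ?(ltW p').
Qed.

(** The derivative in [u] is [1 / (1 + u * s) ^+ 2]; a drop of [u] by [e] therefore costs the third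
    term, up to a second-order error. *)
Lemma residue_accept (R : realFieldType) (u s d e : R) :
  0 <= u <= 1 -> 0 <= d -> d <= s -> s <= 1 -> e <= u -> d <= e ->
  residue u s + u ^+ 2 * d / (1 + u * s) ^+ 2 - e / (1 + u * s) ^+ 2
    - 6 * e ^+ 2 <= residue (u - e) (s - d).
Proof.
move=> u01 d0 ds s1 eu de.
have := residue_wait u01 d0 ds s1; move: u01 => /andP[u0 u1].
have e0 : 0 <= e by lra.
set P := 1 + u * s; set P' := 1 + u * (s - d).
set P'' := 1 + (u - e) * (s - d).
have p : 1 <= P by rewrite /P; nra.
have p' : 1 <= P' by rewrite /P'; nra.
have p'' : 1 <= P'' by rewrite /P''; nra.
have PP : 1 <= P' * P'' by nra.
(* [P'] and [P''] fall short of [P] by at most [e] and [2 * e], and [P <= 2]; this gives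
   [6 = 2 * 3]. *)
have dd : P ^+ 2 - 6 * e <= P' * P''.
  have us1 : 0 <= u * s <= 1 by apply/andP; split; [apply: mulr_ge0|apply: mulr_ile1]; lra.
  have ud : 0 <= u * d <= e.
    by rewrite mulr_ge0 //= (le_trans _ de) // ler_piMl.
  have es : 0 <= e * (s - d) <= e by apply/andP; split; [apply: mulr_ge0|apply: ler_piMr]; lra.
  have -> : P' = P - u * d by rewrite /P /P'; ring.
  have -> : P'' = P - (u * d + e * (s - d)) by rewrite /P /P''; ring.
  move: us1 ud es; rewrite /P; set x := u * s; set y := u * d; set z := e * _.
  move=> /andP[x0 x1] /andP[y0 y1] /andP[z0 z1].
  have : 0 <= (1 - x) * (2 * y + z) by rewrite mulr_ge0; lra.
  have : 0 <= y * (y + z) by rewrite mulr_ge0; lra.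
  by nra.
suff : residue u (s - d) - residue (u - e) (s - d) <= e / P ^+ 2 + 6 * e ^+ 2.
  by lra.
have -> : residue u (s - d) - residue (u - e) (s - d) = e / (P' * P'').
  move: p' p''; rewrite /residue /P' /P'' => p' p''.
  by field; rewrite !gt_eqF //; lra.
rewrite ler_pdivrMr; last by lra.
have -> : e / P ^+ 2 + 6 * e ^+ 2 = e * (1 / P ^+ 2 + 6 * e) by ring.
rewrite -mulrA ler_peMr //.
have P2 : 1 <= P ^+ 2 by nra.
have q0 : 0 <= 1 / P ^+ 2 by rewrite divr_ge0 //; lra.
have q1 : 1 / P ^+ 2 <= 1 by rewrite ler_pdivrMr; lra.
have qP : 1 / P ^+ 2 * P ^+ 2 = 1 by rewrite divfK // gt_eqF; lra.
move: q0 q1 qP; set q := 1 / _ => q0 q1 qP; nra.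
Qed.

Section Process.
Variables (R : realFieldType) (n : nat).
Local Notation T := ('I_n * 'I_n)%type.

(* Expectation for a uniform order [s] and a set [A] of active pairs in which
   each pair is included independently with probability [1 / n]. *)
Definition mean (g : {perm T} -> {set T} -> R) : R :=
  #|{perm T}|%:R^-1 * \sum_s \sum_A weight n%:R^-1 A * g s A.

Hypothesis n1 : (1 < n)%N.

Let ninv01 : 0 <= (n%:R : R)^-1 <= 1.
Proof.
have h : 1 <= n%:R :> R by rewrite ler1n; lia.
by rewrite invr_ge0 ler0n /= invf_le1 // (lt_le_trans ltr01 h).
Qed.

Let K_gt0 : 0 < #|{perm T}|%:R :> R.
Proof. by rewrite ltr0n; apply/card_gt0P; exists 1%g. Qed.

Lemma mean_le g h : (forall s A, g s A <= h s A) -> mean g <= mean h.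
Proof.
move=> gh; rewrite /mean ler_wpM2l ?invr_ge0 ?ler0n //.
apply: ler_sum => s _; apply: ler_sum => A _.
by rewrite ler_wpM2l // weight_ge0.
Qed.

Lemma eq_mean g h : (forall s A, g s A = h s A) -> mean g = mean h.
Proof. by move=> gh; apply/le_anti/andP; split; apply: mean_le => s A; rewrite gh. Qed.

Lemma meanD g h : mean (fun s A => g s A + h s A) = mean g + mean h.
Proof.
rewrite /mean -mulrDr -big_split /=; congr (_ * _); apply: eq_bigr => s _.
by rewrite -big_split /=; apply: eq_bigr => A _; rewrite mulrDr.
Qed.

Lemma meanZ a g : mean (fun s A => a * g s A) = a * mean g.
Proof.
rewrite /mean [RHS]mulrCA; congr (_ * _); rewrite mulr_sumr.
apply: eq_bigr => s _; by rewrite mulr_sumr; apply: eq_bigr => A _; rewrite mulrCA.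
Qed.

Lemma mean_perm (g : {perm T} -> R) :
  mean (fun s _ => g s) = #|{perm T}|%:R^-1 * \sum_s g s.
Proof.
rewrite /mean; congr (_ * _); apply: eq_bigr => s _.
by rewrite -mulr_suml sum_weight mul1r.
Qed.

Lemma mean_cst a : mean (fun _ _ => a) = a.
Proof. by rewrite mean_perm sumr_const -[a *+ _]mulr_natl mulKf // gt_eqF. Qed.

(** * The matching of a deterministic online rule and its free rectangle *)

Variable sel : {perm T} -> {set T} -> {set T}.
Hypothesis sel_active : forall s A, sel s A \subset A.
Hypothesis sel_matching : forall s A t u, t \in sel s A -> u \in sel s A ->
  t != u -> t.1 != u.1 /\ t.2 != u.2.
Hypothesis sel_causal : forall (s s' : {perm T}) (A A' : {set T}) (k : T),
  (forall j, (enum_rank j <= enum_rank k)%N -> s j = s' j) ->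
  (forall j, (enum_rank j <= enum_rank k)%N -> (s j \in A) = (s j \in A')) ->
  (s k \in sel s A) = (s k \in sel s' A').

Definition chosen (i : nat) (s : {perm T}) (A : {set T}) : {set T} :=
  [set t in sel s A | (arrival s t < i)%N]%SET.

(** Written as a product of free rows and free columns, the form that [rect_sum_le] handles. *)
Definition free (M : {set T}) : {set T} :=
  finset.setX (~: [set t.1 | t in M]%SET) (~: [set t.2 | t in M]%SET).

(** A pair placed before [i] in one order has the same position in the other, where [sel_causal]
    applies. *)
Lemma chosen_causal i (s s' : {perm T}) (A A' : {set T}) :
  (forall j, (enum_rank j < i)%N -> s j = s' j) ->
  (forall j, (enum_rank j < i)%N -> (s j \in A) = (s j \in A')) ->
  chosen i s A = chosen i s' A'.
Proof.
move=> hs hA; apply/setP => t; rewrite !inE.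
rewrite /arrival; set k := (s^-1)%g t; set k' := (s'^-1)%g t.
have sk : s k = t by rewrite permKV.
have sk' : s' k' = t by rewrite permKV.
have [ki|ki] := ltnP (enum_rank k) i.
  have e : k' = k by apply: (@perm_inj _ s'); rewrite sk' -hs.
  rewrite e ki !andbT -sk; apply: sel_causal => j jk.
    by apply: hs; apply: leq_ltn_trans jk ki.
  by apply: hA; apply: leq_ltn_trans jk ki.
have [ki'|ki'] := ltnP (enum_rank k') i; last by rewrite !andbF.
have e : k' = k by apply: (@perm_inj _ s); rewrite sk hs.
by move: ki'; rewrite e ltnNge ki.
Qed.

Lemma chosenS i k (s : {perm T}) (A : {set T}) : enum_rank k = i :> nat ->
  #|chosen i.+1 s A| = ((s k \in sel s A) + #|chosen i s A|)%N.
Proof.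
move=> ki; rewrite (cardsD1 (s k)) inE arrivalE ki ltnSn andbT.
congr (_ + #|pred_of_set _|)%N; apply/setP => t; rewrite !inE ltnS leq_eqVlt.
have [->|tk] := eqVneq t (s k); first by rewrite arrivalE ki ltnn andbF.
rewrite (_ : (arrival s t == i) = false) //; apply/negP => /eqP e.
case/eqP: tk; rewrite -[t](permKV s); congr (s _).
by apply/enum_rank_inj/val_inj; rewrite /= ki -e.
Qed.

Lemma sel_free i k (s : {perm T}) (A : {set T}) : enum_rank k = i :> nat ->
  s k \in sel s A -> s k \in free (chosen i s A).
Proof.
move=> ki sk; rewrite !inE -negb_or; apply/negP.
by case/orP => /imsetP[t]; rewrite inE => /andP[tS ti] e;
  have tk : s k != t by [apply/eqP => e'; move: ti; rewrite -e' arrivalE ki ltnn];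
  have [a b] := sel_matching sk tS tk; move: a b; rewrite e eqxx.
Qed.

Lemma card_lines i s A :
  #|[set t.1 | t in chosen i s A]%SET| = #|chosen i s A| /\
  #|[set t.2 | t in chosen i s A]%SET| = #|chosen i s A|.
Proof.
split; apply: card_in_imset => t u; rewrite !inE => /andP[tS _] /andP[uS _] e;
  have [//|tu] := eqVneq t u;
  have [a b] := sel_matching tS uS tu; move: a b; rewrite e eqxx //.
Qed.

Lemma card_chosen_le i s A : (#|chosen i s A| <= n)%N.
Proof. by have [<- _] := card_lines i s A; rewrite -[X in (_ <= X)%N]card_ord max_card. Qed.

(** A matching covers as many rows as columns, so the free rectangle is a square. *)
Lemma card_free i s A :
  #|free (chosen i s A)| = ((n - #|chosen i s A|) ^ 2)%N.
Proof.
have [a b] := card_lines i s A.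
have c (X : {set 'I_n}) : #|~: X| = (n - #|X|)%N.
  by rewrite cardsCs finset.setCK card_ord.
by rewrite cardsX !c a b.
Qed.

(** Given the past, the next pair is active with probability [1 / n] ([sum_weight_coord]) and
    uniform among the unseen pairs ([sum_perm_next]). *)
Lemma mean_next i k (phi : {set T} -> T -> R) : enum_rank k = i :> nat ->
  mean (fun s A => (s k \in A)%:R * phi (chosen i s A) (s k)) =
  n%:R^-1 * (#|{: T}| - i)%:R^-1 *
  mean (fun s A => \sum_(t | (i <= arrival s t)%N) phi (chosen i s A) t).
Proof.
move=> ki.
have iN : (#|{: T}| - i)%:R != 0 :> R.
  by rewrite pnatr_eq0 -lt0n subn_gt0 -ki ltn_ord.
pose h (s : {perm T}) t := \sum_A weight n%:R^-1 A * phi (chosen i s A) t : R.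
transitivity (n%:R^-1 * (#|{perm T}|%:R^-1 * \sum_s h s (s k))).
  rewrite /mean mulrCA; congr (_ * _); rewrite mulr_sumr.
  apply: eq_bigr => s _; apply: sum_weight_coord => A.
  (* The state of [s k] cannot influence [chosen i], which involves earlier positions only. *)
  rewrite (@chosen_causal i s s (s k |: A) (A :\ s k)) // => j ji.
  have jk : s j != s k.
    apply/negP => /eqP /perm_inj jk; by move: ji; rewrite jk ki ltnn.
  by rewrite !inE (negbTE jk).
rewrite -mulrA; congr (_ * _); rewrite /mean [RHS]mulrCA; congr (_ * _).
apply: (mulfI iN); rewrite mulVKf // mulr_natl (sum_perm_next ki).
  apply: eq_bigr => s _; rewrite exchange_big; apply: eq_bigr => A _.
  by rewrite mulr_sumr.
move=> s s' t ss'; apply: eq_bigr => A _; congr (_ * phi _ _).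
by apply: chosen_causal => // j ji; rewrite ss'.
Qed.

Let n0 : 0 < n%:R :> R. Proof. by rewrite ltr0n; lia. Qed.

Let cardT : #|{: T}| = (n * n)%N. Proof. by rewrite card_prod card_ord. Qed.

(** * Density of the free pairs among the unseen ones *)

Definition unmatched i s A : R := 1 - #|chosen i s A|%:R / n%:R.

Lemma unmatched_ge0 i s A : 0 <= unmatched i s A <= 1.
Proof.
rewrite /unmatched subr_ge0 ler_pdivrMr // mul1r ler_nat card_chosen_le /=.
by rewrite gerBl divr_ge0 ?ler0n.
Qed.

Definition free_unseen i (s : {perm T}) (A : {set T}) : R :=
  \sum_(t | (i <= arrival s t)%N) (t \in free (chosen i s A))%:R.

(** The square of [unmatched] is the density of the free pairs among all pairs; the excess tells how
    far the unseen pairs over-represent them. *)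
Definition excess i s A : R :=
  free_unseen i s A / (n * n - i)%:R - unmatched i s A ^+ 2.

Lemma excess_le1 i s A : (i < n * n)%N -> excess i s A <= 1.
Proof.
move=> iN; have iN0 : 0 < (n * n - i)%:R :> R by rewrite ltr0n subn_gt0.
rewrite /excess lerBlDr (@le_trans _ _ 1) ?lerDl ?sqr_ge0 //.
rewrite ler_pdivrMr // mul1r -cardT -card_rank_ge -[X in _ <= X%:R]sum1_card natr_sum.
rewrite /free_unseen (reindex_inj (@perm_inj _ s)) /=.
rewrite (eq_bigl (fun t => (i <= enum_rank t)%N)); last first.
  by move=> t; rewrite arrivalE.
by apply: ler_sum => t _; case: (_ \in _).
Qed.

(** The excess times [n * n - i] is the sum over the free rectangle of a centred indicator of being
    unseen. [rect_sum_le] bounds it for all rectangles at once, so adaptive choices do not matter,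
    and [sum_perm_codegree] averages over the order. *)
Lemma mean_excess4 i : (i < n * n)%N ->
  (n * n - i)%:R ^+ 4 * mean (fun s A => excess i s A ^+ 4) <= 14 * n%:R ^+ 7.
Proof.
move=> iN; have iN0 : 0 < (n * n - i)%:R :> R by rewrite ltr0n subn_gt0.
(* Subtracting the mean makes [f] sum to 0, as [sum_perm_codegree] requires. *)
pose f (t : T) : R := (i <= enum_rank t)%N%:R - (n * n - i)%:R / (n * n)%:R.
have nn0 : (n * n)%:R != 0 :> R by rewrite natrM mulf_neq0 // gt_eqF.
have f0 : \sum_t f t = 0.
  rewrite sumrB sumr_const [X in _ *+ X]cardT -[_ *+ (n * n)]mulr_natr divfK //.
  by rewrite -natr_sum -big_mkcond [X in X%:R]sum1_card card_rank_ge cardT subrr.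
have f1 t : `|f t| <= 1.
  have h : 0 <= ((n * n - i)%:R / (n * n)%:R : R) <= 1.
    rewrite divr_ge0 ?ler0n //= ler_pdivrMr ?lt0r ?nn0 ?ler0n //.
    by rewrite mul1r ler_nat leq_subr.
  by rewrite ler_norml /f; case: leqP => _ /=; lra.
pose Q (s : {perm T}) := \sum_b \sum_b' (\sum_a f (s (a, b)) * f (s (a, b'))) ^+ 2.
have key s A : (n * n - i)%:R ^+ 4 * excess i s A ^+ 4 <=
    (n * n)%:R ^+ 2 * Q (s^-1)%g.
  have := rect_sum_le (fun a b => f ((s^-1)%g (a, b)))
     (~: [set t.1 | t in chosen i s A]%SET) (~: [set t.2 | t in chosen i s A]%SET).
  rewrite card_ord; apply: le_trans.
  rewrite -exprMn; set X := _ * _; set Y := \sum_(a in _) _.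
  rewrite (_ : X = Y) // /X /Y /excess.
  have -> : \sum_(a in ~: [set t.1 | t in chosen i s A]%SET)
     \sum_(b in ~: [set t.2 | t in chosen i s A]%SET) f ((s^-1)%g (a, b)) =
     \sum_(t in free (chosen i s A)) f ((s^-1)%g t).
    rewrite pair_big /=; apply: eq_big => [[a b]|[a b] _] //=.
    by rewrite !inE.
  rewrite sumrB sumr_const card_free mulrBr mulrC divfK ?gt_eqF //.
  congr (_ - _).
    rewrite /free_unseen big_mkcond [RHS]big_mkcond; apply: eq_bigr => t _.
    by rewrite /arrival; do 2!case: ifP.
  rewrite /unmatched -[RHS]mulr_natr natrX (natrB _ (card_chosen_le i s A)).
  by rewrite [(n * n)%:R]natrM; field; rewrite gt_eqF.
rewrite -meanZ (le_trans (mean_le key)) // mean_perm -mulr_sumr.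
(* The inverse of a uniform permutation is uniform. *)
rewrite (reindex_inj invg_inj) /=.
under eq_bigr do rewrite invgK.
have := sum_perm_codegree n1 f0 f1; rewrite -/Q.
rewrite natrM; set S := \sum_s _ => SK.
have -> : 14 * n%:R ^+ 7 = (n%:R * n%:R) ^+ 2 * (14 * n%:R ^+ 3) :> R by ring.
rewrite mulrCA ler_wpM2l ?sqr_ge0 // mulrC ler_pdivrMr //.
Qed.

(** Markov's inequality for the fourth moment; using [h] instead of the number of unseen pairs makes
    the bound uniform in [i]. *)
Lemma mean_excess_le (h i : nat) (theta : R) :
  (h < n * n - i)%N -> (0 < h)%N -> 0 < theta ->
  mean (fun s A => Num.max 0 (excess i s A)) <=
  theta + 14 * n%:R ^+ 7 / (h%:R ^+ 4 * theta ^+ 3).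
Proof.
move=> hi h0 th0; have iN : (i < n * n)%N by lia.
have hR : 0 < h%:R :> R by rewrite ltr0n.
have q0 : 0 < h%:R ^+ 4 :> R by rewrite exprn_gt0.
have t3 : 0 < theta ^+ 3 by rewrite exprn_gt0.
(* Either [excess <= theta], or [excess <= excess ^+ 4 / theta ^+ 3]. *)
apply: (@le_trans _ _ (mean (fun s A => theta + (theta ^+ 3)^-1 * excess i s A ^+ 4))).
  apply: mean_le => s A; set y := excess i s A.
  have y4 : 0 <= (theta ^+ 3)^-1 * y ^+ 4.
    by rewrite mulr_ge0 ?invr_ge0 ?(ltW t3) // (_ : 4%N = (2 * 2)%N) // exprM sqr_ge0.
  rewrite ge_max addr_ge0 ?(ltW th0) //=.
  have [yt|ty] := leP y theta; first by rewrite (le_trans yt) // lerDl.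
  rewrite (@le_trans _ _ ((theta ^+ 3)^-1 * y ^+ 4)) ?lerDr ?(ltW th0) //.
  rewrite mulrC ler_pdivlMr // (exprS y) ler_wpM2l ?(le_trans (ltW th0) (ltW ty)) //.
  by rewrite lerXn2r ?nnegrE ?(ltW th0) ?(le_trans (ltW th0) (ltW ty)) ?(ltW ty).
rewrite meanD mean_cst meanZ lerD2l (invfM (h%:R ^+ 4)) (mulrA (14 * _)) [leLHS]mulrC.
rewrite ler_wpM2r ?invr_ge0 ?(ltW t3) //.
rewrite ler_pdivlMr // mulrC (le_trans _ (mean_excess4 iN)) // ler_wpM2r //.
  rewrite -[X in X <= _](mean_cst 0); apply: mean_le => s A.
  by rewrite (_ : 4%N = (2 * 2)%N) // exprM sqr_ge0.
by rewrite lerXn2r ?nnegrE ?ler0n // ler_nat ltnW.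
Qed.

(** The final unmatched fraction predicted by the greedy flow started from the current state. *)
Definition potential i s A : R :=
  residue (unmatched i s A) (1 - i%:R / (n * n)%:R).

(** In mean, the gain from elapsed time in [residue_wait] balances the loss at an acceptance in
    [residue_accept], up to the excess. The second-order error arises only at acceptances, so it is
    charged to the growth of the matching and telescopes. *)
Lemma mean_potential_step i : (i < n * n)%N ->
  mean (potential i) <= mean (potential i.+1)
    + 6 / (n * n)%:R * (mean (fun s A => #|chosen i.+1 s A|%:R)
                        - mean (fun s A => #|chosen i s A|%:R))
    + (n * n)%:R^-1 * mean (fun s A => Num.max 0 (excess i s A)).
Proof.
move=> iN.
have iT : (i < #|{: T}|)%N by rewrite cardT.
pose k := enum_val (Ordinal iT).
have ki : enum_rank k = i :> nat by rewrite enum_valK.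
pose r : R := 1 - i%:R / (n * n)%:R.
(* [d] is the time step; [e] is both the drop of [unmatched] at an acceptance and the probability of
   activity. The balance of gain and loss rests on [d = e ^+ 2]. *)
pose d : R := (n * n)%:R^-1.
pose e : R := n%:R^-1.
have nnE : (n * n)%:R = n%:R * n%:R :> R by rewrite natrM.
have dE : d = e ^+ 2 by rewrite /d /e nnE invfM expr2.
have e0 : 0 < e by rewrite invr_gt0.
have e1 : e <= 1 by case/andP: ninv01.
have d0 : 0 < d by rewrite dE exprn_gt0.
have rS : 1 - i.+1%:R / (n * n)%:R = r - d.
  by rewrite /r /d -natr1 mulrDl mul1r opprD addrA.
have dr : d <= r.
  rewrite -subr_ge0 -rS subr_ge0 ler_pdivrMr ?mul1r ?ler_nat //.
  by rewrite nnE mulr_gt0.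
have r1 : r <= 1 by rewrite gerBl divr_ge0 ?ler0n.
pose psi (M : {set T}) : R := ((1 + (1 - #|M|%:R / n%:R) * r) ^+ 2)^-1.
pose phi M t : R := psi M * (t \in free M)%:R.
have psi01 s A : 0 <= psi (chosen i s A) <= 1.
  rewrite /psi -/(unmatched i s A); have /andP[u0 u1] := unmatched_ge0 i s A.
  have P1 : 1 <= 1 + unmatched i s A * r by rewrite lerDl mulr_ge0 //; lra.
  by rewrite invr_ge0 sqr_ge0 /= invf_le1 ?exprn_ege1 // exprn_gt0 //; lra.
(* An accepted pair is active and free, so the last term pays for its loss; if the pair is rejected,
   that term is merely nonnegative. *)
have pointwise s A : potential i s A
    + d * (psi (chosen i s A) * unmatched i s A ^+ 2)
    + 6 * d * #|chosen i s A|%:R <=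
    potential i.+1 s A + 6 * d * #|chosen i.+1 s A|%:R
    + e * ((s k \in A)%:R * phi (chosen i s A) (s k)).
  have u01 := unmatched_ge0 i s A.
  rewrite /potential rS -/r (chosenS s A ki).
  have -> : unmatched i.+1 s A = unmatched i s A - e * (s k \in sel s A)%:R.
    by rewrite /unmatched (chosenS s A ki) natrD /e; ring.
  have [sk|sk] := boolP (s k \in sel s A) => /=; last first.
    rewrite mulr0 subr0 add0n.
    have := residue_wait u01 (ltW d0) dr r1.
    have : 0 <= e * ((s k \in A)%:R * phi (chosen i s A) (s k)).
      have /andP[p0 _] := psi01 s A.
      by rewrite mulr_ge0 ?(ltW e0) // mulr_ge0 ?ler0n // mulr_ge0 ?ler0n.
    rewrite /psi -/(unmatched i s A) (mulrC (unmatched _ _ _ ^+ 2)).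
    by rewrite -(mulrA d) (mulrC (unmatched _ _ _ ^+ 2)) mulrA; lra.
  rewrite (fintype.subsetP (sel_active s A) _ sk) /phi (sel_free ki sk) !mulr1 mul1r.
  have eu : e <= unmatched i s A.
    have := card_chosen_le i.+1 s A; rewrite (chosenS s A ki) sk => c1.
    have : #|chosen i s A|%:R + 1 <= n%:R :> R by rewrite natr1 ler_nat.
    rewrite /unmatched /e => c2; rewrite lerBrDr -[X in X + _]mul1r -mulrDl.
    by rewrite ler_pdivrMr // mul1r addrC.
  have de : d <= e by rewrite dE expr2 ler_piMl ?(ltW e0).
  have := residue_accept u01 (ltW d0) dr r1 eu de.
  rewrite -dE natrD /psi -/(unmatched i s A).
  set p := (_ ^+ 2)^-1. by lra.
have := mean_le pointwise; rewrite !meanD !meanZ (mean_next phi ki) cardT.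
(* The free unseen pairs are counted by [unmatched ^+ 2 + excess], times the number of unseen pairs;
   [psi <= 1] removes the factor in front of the excess. *)
have density s A : \sum_(t | (i <= arrival s t)%N) phi (chosen i s A) t <=
   (n * n - i)%:R * (psi (chosen i s A) * unmatched i s A ^+ 2
    + Num.max 0 (excess i s A)).
  rewrite /phi -mulr_sumr -/(free_unseen i s A).
  have -> : free_unseen i s A =
     (n * n - i)%:R * (unmatched i s A ^+ 2 + excess i s A).
    rewrite /excess addrC subrK mulrC divfK //.
    by rewrite pnatr_eq0 subn_eq0 -ltnNge.
  rewrite mulrCA ler_wpM2l ?ler0n // mulrDr lerD2l.
  have /andP[p0 p1] := psi01 s A.
  apply: (@le_trans _ _ (psi (chosen i s A) * Num.max 0 (excess i s A))).
    by rewrite ler_wpM2l // le_max lexx orbT.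
  by rewrite ler_piMl // le_max lexx.
have := mean_le density; rewrite meanZ meanD => D.
have iN0 : 0 < (n * n - i)%:R :> R by rewrite ltr0n subn_gt0.
rewrite -ler_pdivrMl // in D.
have := ler_wpM2l (ltW d0) D; rewrite -/d -/e; set Z := mean _ => D' P.
have EZ : e * (e / (n * n - i)%:R * Z) = d * ((n * n - i)%:R^-1 * Z).
  by rewrite dE; ring.
by rewrite EZ in P; lra.
Qed.

(* The last [h] steps, where too few pairs are unseen for the fourth moment bound
   to help, are bounded trivially and cost [h / n ^+ 2]. *)
Lemma mean_chosen_le (h : nat) (theta : R) :
  (0 < h < n * n)%N -> 0 < theta ->
  mean (fun s A => #|sel s A|%:R) <=
  n%:R * (1 / 2 + 6 / n%:R + h%:R / n%:R ^+ 2 + theta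
    + 14 * n%:R ^+ 7 / (h%:R ^+ 4 * theta ^+ 3)).
Proof.
move=> /andP[h0 hn] th0.
set D := 14 * _ / _.
have D0 : 0 <= D.
  by rewrite divr_ge0 ?mulr_ge0 ?exprn_ge0 ?ler0n ?(ltW th0).
pose N : R := (n * n)%:R; pose e i : R := if (i < n * n - h)%N then theta + D else 1.
have N0 : 0 < N by rewrite ltr0n muln_gt0 ltnW.
have eE i : (i < n * n)%N -> mean (fun s A => Num.max 0 (excess i s A)) <= e i.
  move=> iN; rewrite /e; case: ifP => ih.
    by apply: mean_excess_le => //; lia.
  rewrite -[leRHS]mean_cst; apply: mean_le => s A.
  by rewrite ge_max ler01 excess_le1.
(* The added term absorbs the error charged to acceptances, so [W] decreases by at most [e i / N]
   per step. *)
pose W i := mean (potential i) + 6 / N * mean (fun s A => #|chosen i s A|%:R).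
have step i : (i <= n * n)%N -> W 0%N <= W i + N^-1 * \sum_(j < i) e j.
  elim: i => [|i IH] iN; first by rewrite big_ord0 mulr0 addr0.
  apply: (le_trans (IH (ltnW iN))); rewrite big_ord_recr /=.
  have := mean_potential_step iN; rewrite -/N /W => P.
  have := eE i iN; rewrite -(ler_pM2l (_ : 0 < N^-1)) ?invr_gt0 // => Q.
  by lra.
have c0 s A : #|chosen 0 s A| = 0%N.
  by apply/eqP; rewrite cards_eq0; apply/eqP/setP => t; rewrite !inE ltn0 andbF.
have W0 : W 0%N = 1 / 2.
  rewrite /W; have -> : mean (potential 0) = 1 / 2.
    rewrite -[RHS]mean_cst; apply: eq_mean => s A.
    by rewrite /potential /residue /unmatched c0 !mul0r !subr0 !mulr1.
  rewrite -[RHS]addr0; congr (_ + _); rewrite -[X in _ * X](_ : 0 = _) ?mulr0 //.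
  by rewrite -[LHS]mean_cst; apply: eq_mean => s A; rewrite c0.
have cN s A : chosen (n * n) s A = sel s A.
  apply/setP => t; rewrite !inE; case: (_ \in _) => //=.
  by rewrite -cardT ltn_ord.
have sum_e : \sum_(j < n * n) e j <= N * (theta + D) + h%:R.
  apply: (@le_trans _ _ (\sum_(j < n * n) (theta + D + (n * n - h <= j)%N%:R))).
    apply: ler_sum => j _; rewrite /e; case: ltnP => _; first by rewrite addr0.
    by rewrite lerDr addr_ge0 ?(ltW th0).
  rewrite big_split /= sumr_const card_ord -[_ *+ _]mulr_natl lerD2l.
  rewrite -(big_mkord predT (fun j => ((n * n - h <= j)%N%:R : R))).
  rewrite (big_cat_nat (leq0n _) (leq_subr h _)) /= big_nat big1 ?add0r; last first.
    by move=> j /andP[_ jh]; rewrite leqNgt jh.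
  rewrite big_nat (eq_bigr (fun=> 1)); last by move=> j /andP[-> _].
  by rewrite -big_nat sumr_const_nat subKn // ltnW.
have := step _ (leqnn _); rewrite W0 /W.
have -> : mean (potential (n * n)) = 1 - mean (fun s A => #|sel s A|%:R) / n%:R.
  rewrite mulrC -[X in X - _](mean_cst 1) -mulNr -meanZ -meanD.
  apply: eq_mean => s A; rewrite /potential divff ?gt_eqF // subrr.
  by rewrite /residue mulr0 addr0 divr1 /unmatched cN; ring.
have -> : mean (fun s A => #|chosen (n * n) s A|%:R) =
    mean (fun s A => #|sel s A|%:R) by apply: eq_mean => s A; rewrite cN.
set m := mean _ => H.
have mn : m <= n%:R.
  rewrite -[leRHS]mean_cst; apply: mean_le => s A.
  by rewrite ler_nat -cN card_chosen_le.
have H1 : N^-1 * \sum_(j < n * n) e j <= theta + D + h%:R / n%:R ^+ 2.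
  rewrite mulrC ler_pdivrMr // (le_trans sum_e) // mulrDl [leLHS]addrC.
  rewrite [leRHS]addrC mulrC lerD2r /N natrM -expr2 divfK // expf_neq0 //.
  by rewrite gt_eqF.
(* At most [n] acceptances occur, each charged [6 / n ^ 2]. *)
have H2 : 6 / N * m <= 6 / n%:R.
  have -> : 6 / N * m = 6 / n%:R * (m / n%:R).
    by rewrite /N natrM; field; rewrite gt_eqF.
  by rewrite ler_piMr ?divr_ge0 ?ler0n // ler_pdivrMr // mul1r.
rewrite mulrC -ler_pdivrMr //; lra.
Qed.

End Process.

(** * Schemes on the complete bipartite graph *)

(** Averaging over the seed: a bound on a weighted count that holds for every [w] passes to the
    integral, and the integral of each indicator is a probability. *)
Lemma sum_fine_probability_le (R : realType) (d : measure_display)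
    (W : measurableType d) (P : probability W R) (I : finType)
    (p : I -> R) (S : I -> set W) (b : R) :
  (forall i, 0 <= p i) -> (forall i, measurable (S i)) ->
  (forall w, \sum_i p i * (`[< S i w >])%:R <= b) ->
  \sum_i p i * fine (P (S i)) <= b.
Proof.
move=> p0 mS hb.
have fI i : (fun w => (p i * (`[< S i w >])%:R)%:E) =
    (fun w => (p i)%:E * (\1_(S i) w)%:E)%E.
  apply/funext => w; rewrite -EFinM indicE (_ : w \in S i = `[< S i w >]) //.
have mI i : measurable_fun [set: W]%classic (fun w => (p i * (`[< S i w >])%:R)%:E : \bar R).
  rewrite fI; apply: measurable_funeM; apply/measurable_EFinP.
  exact: measurable_indic.
have I0 i w : (0 <= (p i * (`[< S i w >])%:R)%:E)%E.
  by rewrite lee_fin mulr_ge0 ?ler0n.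
rewrite -lee_fin.
have -> : ((\sum_i p i * fine (P (S i)))%:E =
    \int[P]_w (\sum_i (p i * (`[< S i w >])%:R)%:E))%E.
  rewrite ge0_integral_sum // -sumEFin; apply: eq_bigr => i _.
  rewrite fI ge0_integralZl //; last first.
  - by rewrite lee_fin.
  - by apply/measurable_EFinP; exact: measurable_indic.
  by rewrite integral_indic // setIT EFinM fineK // fin_num_measure.
have b0 : 0 <= b.
  have w : W by exact: point.
  by apply: le_trans (hb w); apply: sumr_ge0 => i _; rewrite mulr_ge0 ?ler0n.
apply: (@le_trans _ _ (\int[P]_(w in [set: W]%classic) b%:E)%E).
  apply: ge0_le_integral => //.
  - by move=> w _; apply: sume_ge0.
  - by apply: emeasurable_sum.
  - by move=> w _; rewrite sumEFin lee_fin.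
rewrite integral_cst // -[leRHS]mule1 le_eqVlt; apply/orP; left; apply/eqP.
by congr (_ * _)%E; exact: probability_setT.
Qed.

Definition list_order (T : finType) (E : eqType) (g : T -> E) (s : {perm T}) : seq E :=
  [seq g (s t) | t <- enum T].

Lemma card_perm_type (T : finType) : #|{perm T}| = (#|T|)`!.
Proof.
rewrite -[in RHS]cardsT -(card_perm [set: T]%SET).
apply: eq_card => s; rewrite [LHS]inE; apply/esym.
have h : perm_on [set: T]%SET s by apply/fintype.subsetP => t _; rewrite finset.in_setT.
exact: h.
Qed.

(** Turns sums over arrival orders into sums over [{perm T}]. The listed orders are distinct
    permutations of [enum E], and both sides have [#|T|] factorial members. *)
Lemma perm_permutations_enum (T E : finType) (g : T -> E) : bijective g ->
  perm_eq (permutations (enum E)) [seq list_order g s | s <- enum {perm T}].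
Proof.
move=> bg; have ig := bij_inj bg.
have U : uniq [seq list_order g s | s <- enum {perm T}].
  rewrite map_inj_uniq ?enum_uniq // => s s' /eq_in_map e.
  by apply/permP => t; apply: ig; apply: e; rewrite mem_enum.
have sub : {subset [seq list_order g s | s <- enum {perm T}] <= permutations (enum E)}.
  move=> _ /mapP[s _ ->]; rewrite mem_permutations; apply: uniq_perm.
  - by rewrite map_inj_uniq ?enum_uniq // => t u /ig /perm_inj.
  - exact: enum_uniq.
  move=> e; rewrite mem_enum inE; have [h gK hK] := bg.
  by apply/mapP; exists ((s^-1)%g (h e)); rewrite ?mem_enum // permKV hK.
have [|_ eqi] := uniq_min_size U sub.
  rewrite size_permutations ?enum_uniq // (size_map (list_order g)) -!cardE card_perm_type.
  by rewrite (bij_eq_card bg).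
by apply: uniq_perm; rewrite ?permutations_uniq // => l; rewrite eqi.
Qed.

(** * The complete bipartite graph with its uniform fractional matching *)

Section Knn.
Variable n : nat.
Local Notation T := ('I_n * 'I_n)%type.
Local Notation V := ('I_n + 'I_n)%type.

Definition bond (t : T) : {set V} := [set inl t.1; inr t.2]%SET.

Lemma bond_inl t a : (inl a \in bond t) = (a == t.1).
Proof. by rewrite !inE orbF. Qed.

Lemma bond_inr t a : (inr a \in bond t) = (a == t.2).
Proof. by rewrite !inE. Qed.

Lemma bond_inj : injective bond.
Proof.
move=> [a b] [a' b'] /setP e.
have := e (inl a); rewrite !bond_inl /= eqxx => /esym/eqP ->.
by have := e (inr b); rewrite !bond_inr /= eqxx => /esym/eqP ->.
Qed.

Lemma bond_card2 (e : {set V}) : e \in [set bond t | t : T]%SET -> #|e| = 2%N.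
Proof. by case/imsetP => t _ ->; rewrite cards2. Qed.

Definition Knn : graph := Graph bond_card2.

Lemma bond_edge t : bond t \in edges Knn.
Proof. exact: imset_f. Qed.

Definition Knn_edge (t : T) : edge Knn := Sub (bond t) (bond_edge t).

Lemma endpoints_Knn_edge t : endpoints (Knn_edge t) = bond t.
Proof. by []. Qed.

Lemma Knn_edge_bij : bijective Knn_edge.
Proof.
have i : injective Knn_edge by move=> t u /(congr1 val) /bond_inj.
apply: inj_card_bij => //; rewrite card_sig -(card_imset _ bond_inj).
by apply/subset_leq_card/fintype.subsetP => e; rewrite inE.
Qed.

Lemma Knn_edgeP e : {t | e = Knn_edge t}.
Proof.
apply: sig_eqW; case: Knn_edge_bij => h _ hK; exists (h e); exact/esym/hK.
Qed.

Lemma Knn_bipartite : bipartite Knn.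
Proof.
exists [set inl a | a : 'I_n]%SET => e; have [t ->] := Knn_edgeP e.
exists (inl t.1), (inr t.2); split => //; first exact: imset_f.
by apply/imsetP => -[].
Qed.

(** Each vertex lies in exactly [n] edges, a full row or a full column of pairs. *)
Lemma uniform_fractional (R : realType) : (0 < n)%N ->
  @fractional_matching R Knn (fun=> n%:R^-1).
Proof.
move=> n0; have nR : n%:R != 0 :> R by rewrite pnatr_eq0 -lt0n.
split=> [e|v].
  by rewrite invr_ge0 ler0n /= invf_le1 ?ler1n // ltr0n.
rewrite (reindex _ (onW_bij _ Knn_edge_bij)) /=.
rewrite sumr_const -[_ *+ _]mulr_natl ler_pdivrMr ?ltr0n // mul1r ler_nat.
case: v => a.
  rewrite (eq_card (B := finset.setX [set a]%SET [set: 'I_n]%SET)).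
    by rewrite cardsX cards1 cardsT card_ord mul1n.
  by move=> t; transitivity (inl a \in bond t) => //; rewrite bond_inl !inE andbT eq_sym.
rewrite (eq_card (B := finset.setX [set: 'I_n]%SET [set a]%SET)).
  by rewrite cardsX cards1 cardsT card_ord muln1.
by move=> t; transitivity (inr a \in bond t) => //; rewrite bond_inr !inE eq_sym.
Qed.

End Knn.

(** The history at position [k] reads [s] at earlier positions only, which makes a scheme causal in
    the sense of [sel_causal]. *)
Lemma history_list_order (G : graph) (T : finType) (g : T -> edge G)
    (s : {perm T}) (A : {set edge G}) (k : T) : injective g ->
  history (list_order g s) A (g (s k)) =
  [seq (g (s j), g (s j) \in A) | j <- take (enum_rank k) (enum T)].
Proof.
move=> gi; rewrite /history /list_order.
rewrite (index_map (f := fun t => g (s t))); last by move=> t u /gi /perm_inj.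
rewrite -map_take -map_comp; congr (map _ (take _ _)).
rewrite -[in LHS](nth_enum_rank k k) index_uniq ?enum_uniq // -cardE.
exact: ltn_ord.
Qed.

Lemma activity_prob_weight (R : realType) (G : graph) (T : finType)
    (g : T -> edge G) (x : R) (A : {set T}) : bijective g ->
  activity_prob (fun=> x) [set g t | t in A]%SET = weight x A.
Proof.
move=> bg; have gi := bij_inj bg.
rewrite /activity_prob /weight !prodr_const (bigID (mem A)) /=.
rewrite [X in _ = X * _](eq_bigr (fun=> x)); last by move=> t ->.
rewrite [X in _ = _ * X](eq_bigr (fun=> 1 - x)); last by move=> t /negbTE ->.
rewrite !prodr_const card_imset //; congr (_ * _ ^+ _).
rewrite [LHS]cardsCs finset.setCK card_imset // -(bij_eq_card bg).
by rewrite -(cardC A) addKn.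
Qed.

(** * From schemes to deterministic rules on pairs *)

Section Scheme.
Variables (R : realType) (n : nat) (S : scheme R (Knn n)).
Local Notation T := ('I_n * 'I_n)%type.
Local Notation g := (@Knn_edge n).

(** With the seed frozen, this is an instance of [sel]. *)
Definition matched (w : seed S) (s : {perm T}) (A : {set T}) : {set T} :=
  [set t | g t \in selected (@accept R _ S) w (list_order g s) [set g u | u in A]]%SET.

Lemma list_order_is_order (s : {perm T}) : is_order (list_order g s).
Proof.
rewrite /is_order -mem_permutations (perm_mem (perm_permutations_enum (Knn_edge_bij n))).
by apply: map_f; rewrite mem_enum.
Qed.

Lemma matched_active w s A : matched w s A \subset A.
Proof.
apply/fintype.subsetP => t; rewrite inE => h.
have := fintype.subsetP (accept_active w [set g u | u in A]%SET (list_order_is_order s)) _ h.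
by rewrite mem_imset //; exact: bij_inj (Knn_edge_bij n).
Qed.

Lemma matched_matching w s A t u : t \in matched w s A -> u \in matched w s A ->
  t != u -> t.1 != u.1 /\ t.2 != u.2.
Proof.
rewrite inE => ht; rewrite inE => hu tu.
have gtu : g t != g u by rewrite (inj_eq (bij_inj (Knn_edge_bij n))).
have := accept_matching (list_order_is_order s) ht hu gtu.
rewrite !endpoints_Knn_edge => /pred0P D; split; apply/eqP => e.
  have := D (inl t.1); rewrite /= !bond_inl e eqxx //.
have := D (inr t.2); rewrite /= !bond_inr e eqxx //.
Qed.

Lemma matched_causal w (s s' : {perm T}) (A A' : {set T}) (k : T) :
  (forall j, (enum_rank j <= enum_rank k)%N -> s j = s' j) ->
  (forall j, (enum_rank j <= enum_rank k)%N -> (s j \in A) = (s j \in A')) ->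
  (s k \in matched w s A) = (s k \in matched w s' A').
Proof.
have gi := bij_inj (Knn_edge_bij n).
move=> hs hA; rewrite !inE !mem_imset // hA //.
congr (accept _ _ _ _); rewrite [in RHS]hs // !history_list_order //.
apply/eq_in_map => j jk; have {}jk : (enum_rank j <= enum_rank k)%N.
  move: jk; rewrite in_take ?mem_enum //.
  rewrite -[in index _](nth_enum_rank j j) index_uniq ?enum_uniq -?cardE ?ltn_ord //.
  exact: ltnW.
by rewrite !mem_imset // -hs // hA.
Qed.

Lemma selection_prob_matched t :
  selection_prob (fun=> n%:R^-1) S (g t) =
  mean (fun s A => fine (seed_law S [set w | t \in matched w s A]%classic)).
Proof.
have bg := Knn_edge_bij n.
rewrite /selection_prob /mean -(bij_eq_card bg) -card_perm_type; congr (_ * _).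
rewrite (perm_big _ (perm_permutations_enum bg)) big_map big_enum /=.
apply: eq_bigr => s _.
have bi : bijective (fun A : {set T} => [set g u | u in A]%SET).
  have [h gK hK] := bg; exists (fun B : {set edge (Knn n)} => [set h e | e in B]%SET) => B.
    by rewrite -imset_comp (eq_imset _ gK) imset_id.
  by rewrite -imset_comp (eq_imset _ hK) imset_id.
rewrite (reindex _ (onW_bij _ bi)) /=; apply: eq_bigr => A _.
rewrite activity_prob_weight //; congr (_ * fine (seed_law S _)).
by apply/seteqP; split => w /=; rewrite [t \in _]inE.
Qed.

(** The selection probabilities add up to the expected size of the matching, so a bound valid for
    each seed suffices. *)
Lemma sum_selection_prob_le (b : R) : (1 < n)%N ->
  (forall w, mean (fun s A => #|matched w s A|%:R) <= b) ->
  \sum_t selection_prob (fun=> n%:R^-1) S (g t) <= b.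
Proof.
move=> n1 hb.
(* Order, active set and pair form a single index, to fit [sum_fine_probability_le]. *)
pose p (i : {perm T} * {set T} * T) : R :=
  #|{perm T}|%:R^-1 * weight n%:R^-1 i.1.2.
pose E (i : {perm T} * {set T} * T) : set (seed S) :=
  [set w | i.2 \in matched w i.1.1 i.1.2]%classic.
have flat (f : {perm T} -> {set T} -> T -> R) :
    mean (fun s A => \sum_t f s A t) = \sum_i p i * f i.1.1 i.1.2 i.2.
  rewrite -(pair_bigA _ (fun q t => p (q, t) * f q.1 q.2 t)) /=.
  rewrite -(pair_bigA _ (fun s A => \sum_t p ((s, A), t) * f s A t)) /=.
  rewrite /mean mulr_sumr; apply: eq_bigr => s _.
  rewrite mulr_sumr; apply: eq_bigr => A _.
  by rewrite mulrA mulr_sumr.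
rewrite (eq_bigr _ (fun t _ => selection_prob_matched t)).
have -> : \sum_t mean (fun s A => fine (seed_law S [set w | t \in matched w s A]%classic))
    = \sum_i p i * fine (seed_law S (E i)).
  rewrite -(flat (fun s A t => fine (seed_law S [set w | t \in matched w s A]%classic))).
  rewrite /mean -mulr_sumr; congr (_ * _); rewrite exchange_big; apply: eq_bigr => s _.
  by rewrite exchange_big; apply: eq_bigr => A _; rewrite mulr_sumr.
apply: sum_fine_probability_le => [i|i|w].
- rewrite mulr_ge0 ?invr_ge0 ?ler0n // weight_ge0 //.
  by rewrite invr_ge0 ler0n invf_le1 ?ler1n ?ltr0n //; lia.
- rewrite /E; set t := i.2; set s := i.1.1; set A := i.1.2.
  rewrite (_ : [set w | _]%classic = [set w | accept w
     (history (list_order g s) [set g u | u in A]%SET (g t)) (g t)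
     (g t \in [set g u | u in A]%SET)]%classic); first exact: accept_measurable.
  by apply/seteqP; split => w /=; rewrite !inE.
- apply: le_trans (hb w).
  rewrite -(flat (fun s A t => (`[< t \in matched w s A >])%:R)).
  apply: mean_le => // s A; rewrite -sum1_card natr_sum [leRHS]big_mkcond.
  by apply: ler_sum => t _; rewrite asboolb; case: (_ \in _).
Qed.

End Scheme.

(** Each of the [n * n] edges is selected with probability at least [c / n], so the expected size of
    the matching is at least [c * n]. *)
Lemma selectability_le (R : realType) (c : R) (rho : rcrs R) (n h : nat) (theta : R) :
  selectable_on (fun I : input R => bipartite (igraph I)) c rho ->
  (1 < n)%N -> (0 < h < n * n)%N -> 0 < theta ->
  c <= 1 / 2 + 6 / n%:R + h%:R / n%:R ^+ 2 + theta
    + 14 * n%:R ^+ 7 / (h%:R ^+ 4 * theta ^+ 3).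
Proof.
move=> hsel n1 hn th0; have n0 : 0 < n%:R :> R by rewrite ltr0n; lia.
pose I : input R := Input (@uniform_fractional n R (ltnW n1)).
have := hsel I (Knn_bipartite n) => /= hc.
rewrite -(ler_pM2l n0); apply: le_trans (sum_selection_prob_le (S := rho I) n1 _).
  apply: (@le_trans _ _ (\sum_(t : 'I_n * 'I_n) c * n%:R^-1)).
    rewrite sumr_const card_prod card_ord -[leRHS]mulr_natl natrM.
    by rewrite le_eqVlt; apply/orP; left; apply/eqP; field; rewrite gt_eqF.
  by apply: ler_sum => t _; exact: hc.
move=> w; apply: mean_chosen_le => //.
- exact: matched_active.
- exact: matched_matching.
- exact: matched_causal.
Qed.

Theorem theorem5 (R : realType) (c : R) (rho : rcrs R)
  (hsel : selectable_on (fun I : input R => bipartite (igraph I)) c rho) :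
  c <= 1 / 2.
Proof.
rewrite leNgt; apply/negP => c2.
have d0 : 0 < c - 1 / 2 by rewrite subr_gt0.
(* With [n = L ^ 8], [h = L ^ 15] and [theta = 1 / L], the four error terms are at most 6, 1, 1 and
   14 times [1 / L], in total [22 / L]. The [.+2] ensures [L > 1], so that [L ^ 15 < L ^ 16]. *)
pose L := (Num.bound (22 / (c - 1 / 2))).+2.
have L0 : 0 < L%:R :> R by rewrite ltr0n.
have L1 : 1 <= L%:R :> R by rewrite ler1n.
have bL : 22 / L%:R < c - 1 / 2.
  rewrite ltr_pdivrMr // mulrC -ltr_pdivrMr //.
  apply: lt_le_trans (archi_boundP _) _; first by rewrite divr_ge0 // ltW.
  by rewrite ler_nat; apply: leqW; exact: leqnSn.
have h : (0 < L ^ 15 < L ^ 8 * L ^ 8)%N.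
  by rewrite expn_gt0 /= -expnD ltn_exp2l.
have n1 : (1 < L ^ 8)%N by rewrite -{1}(exp1n 8) ltn_exp2r.
have t0 : 0 < L%:R^-1 :> R by rewrite invr_gt0.
have := selectability_le hsel n1 h t0; rewrite !natrX.
have -> : L%:R ^+ 15 / (L%:R ^+ 8) ^+ 2 = 1 / L%:R :> R by field; rewrite gt_eqF.
have -> : 14 * (L%:R ^+ 8) ^+ 7 / ((L%:R ^+ 15) ^+ 4 * L%:R^-1 ^+ 3) = 14 / L%:R :> R.
  by field; rewrite gt_eqF.
have : 6 / L%:R ^+ 8 <= 6 / L%:R :> R.
  by rewrite ler_pM2l // lef_pV2 ?posrE ?exprn_gt0 // ler_eXnr.
move: bL; set y := L%:R^-1; set z := 6 / _ ^+ 8. lra.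
Qed.
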